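(* Let $F_2=[B_3,B_3]$ be the commutator subgroup of the braid group $B_3$, which is free on the two generators $x=\sigma_1\sigma_2^{-1}$ and $y=\sigma_1^2\sigma_2^{-2}$. Let $n>2$ be an integer, and let $K_n\subset F_2$ be the kernel of the homomorphism $F_2\to\mathbb{Z}_{n-1}$ defined by $x\mapsto 1$, $y\mapsto 0$. Then the restriction of the Dehornoy ordering of $B_3$ to the subgroup $K_n\subset F_2=[B_3,B_3]$ has no proper, nontrivial convex subgroups; that is, if $C\subset K_n$ is a subgroup that is convex in $K_n$ with respect to this restricted ordering, then $C=\{1\}$ or $C=K_n$.
   Context: Left orderings: a left ordering of a group $G$ is a strict total ordering $<$ of its elements such that $g<h$ implies $fg<fh$ for all $f,g,h \in G$. Its positive cone is $P=\{g\in G : g>1\}$, which satisfies $P\cdot P\subset P$ and $P\sqcup P^{-1}\sqcup\{1\}=G$; conversely any subset $P$ with these two properties defines a left ordering by $g<h$ if and only if $g^{-1}h\in P$. Convex subgroups: a subgroup $H\subset G$ is convex in $G$ with respect to $<$ if whenever $f,h\in H$, $g\in G$ and $f<g<h$, then $g\in H$. Braid group: $B_3=\langle \sigma_1,\sigma_2 \mid \sigma_1\sigma_2\sigma_1=\sigma_2\sigma_1\sigma_2\rangle$. Dehornoy ordering: for $i\in\{1,2\}$, a word in the generators $\sigma_i,\dots,\sigma_2$ and their inverses is $i$-positive if the generator $\sigma_i$ occurs in it and occurs only with positive exponents. (So a $1$-positive word is a word in $\sigma_1^{\pm1},\sigma_2^{\pm1}$ containing $\sigma_1$ but not $\sigma_1^{-1}$,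 and a $2$-positive word is a positive power of $\sigma_2$.) A braid is $i$-positive if it is represented by some $i$-positive word. The set $P_D=\{\beta\in B_3 : \beta \text{ is } i\text{-positive for some } i\le 2\}$ is the positive cone of a left ordering of $B_3$, called the Dehornoy ordering (known theorem of Dehornoy). Its restriction to a subgroup $K$ is the left ordering of $K$ with positive cone $K\cap P_D$. It is known that $[B_3,B_3]$ is free of rank $2$, freely generated by $x=\sigma_1\sigma_2^{-1}$ and $y=\sigma_1^2\sigma_2^{-2}$. $\mathbb{Z}_{n-1}$ denotes the cyclic group of order $n-1$ (written additively). *)

(* Defs.v *)
From HB Require Import structures.
From mathcomp Require Import all_boot all_order all_algebra ring.
From mathcomp Require Import boolp classical_sets.

Set Implicit Arguments.
Unset Strict Implicit.
Unset Printing Implicit Defensive.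

Import GRing.Theory.

Local Open Scope classical_set_scope.
Local Open Scope group_scope.

Section Subgroups.
Variable G : groupType.
Implicit Types (A C K P : set G) (lt : G -> G -> Prop).

Definition is_subgroup C : Prop := group_closed (mem C).

Definition generated A : set G :=
  [set g | forall C, is_subgroup C -> A `<=` C -> C g].

Definition commutator_subgroup : set G :=
  generated [set c | exists g h : G, c = [~ g, h]].

Definition cone_lt P : G -> G -> Prop := fun g h => P (g^-1 * h).

Definition convex_in K lt C : Prop :=
  forall f g h, C f -> K g -> C h -> lt f g -> lt g h -> C g.

(* The values of phi outside K are irrelevant. *)
Definition additive_on K (V : zmodType) (phi : G -> V) : Prop :=
  forall g h, K g -> K h -> phi (g * h) = (phi g + phi h)%R.

Definition kernel_on K (V : zmodType) (phi : G -> V) : set G :=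
  [set g | K g /\ phi g = 0%R].

End Subgroups.

(* Indices start at 0: the letter (i, true) stands for sigma_(i+1), and
   (i, false) for its inverse. *)
Definition letter := ('I_2 * bool)%type.
Definition word := seq letter.

Definition letter_inv (l : letter) : letter := (l.1, ~~ l.2).
Definition word_inv (w : word) : word := rev (map letter_inv w).

Definition s1 : letter := (ord0, true).
Definition s2 : letter := (ord_max, true).

Inductive braid_cong : word -> word -> Prop :=
| bc_refl u : braid_cong u u
| bc_sym u v : braid_cong u v -> braid_cong v u
| bc_trans u v w : braid_cong u v -> braid_cong v w -> braid_cong u w
| bc_cat u u' v v' :
    braid_cong u u' -> braid_cong v v' -> braid_cong (u ++ v) (u' ++ v')
| bc_cancel l : braid_cong [:: l; letter_inv l] [::]
| bc_braid : braid_cong [:: s1; s2; s1] [:: s2; s1; s2].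

Definition braid_congb : rel word := fun u v => `[< braid_cong u v >].

Lemma braid_congb_equiv : equiv_class_of braid_congb.
Proof.
split=> [u|u v|v u w].
- exact/asboolP/bc_refl.
- by apply/asboolP/asboolP; apply: bc_sym.
- by move=> /asboolP uv /asboolP vw; apply/asboolP; apply: bc_trans vw.
Qed.

Canonical braid_congb_equiv_rel := EquivRelPack braid_congb_equiv.

Definition B3 := {eq_quot braid_congb}%qT.
HB.instance Definition _ := Choice.on B3.
HB.instance Definition _ := EqQuotient.on B3.

Definition braid_of (w : word) : B3 := (\pi_B3 w)%qT.

Lemma braid_ofP u v : braid_of u = braid_of v <-> braid_cong u v.
Proof. by split=> [/eqmodP/asboolP|uv] //; apply/eqmodP/asboolP. Qed.

Lemma braid_of_repr (b : B3) : braid_of (repr b) = b.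
Proof. exact: reprK. Qed.

Lemma repr_braid_of w : braid_cong (repr (braid_of w)) w.
Proof. by apply/braid_ofP; rewrite braid_of_repr. Qed.

Lemma letter_invK : involutive letter_inv.
Proof. by case=> i b; rewrite /letter_inv /= negbK. Qed.

Lemma word_invK : involutive word_inv.
Proof. by move=> w; rewrite /word_inv map_rev revK (mapK letter_invK). Qed.

Lemma word_inv_cat u v : word_inv (u ++ v) = word_inv v ++ word_inv u.
Proof. by rewrite /word_inv map_cat rev_cat. Qed.

Lemma word_mulV w : braid_cong (w ++ word_inv w) [::].
Proof.
elim: w => [|l w IHw]; first exact: bc_refl.
rewrite -cat1s word_inv_cat -catA (catA w) /=.
apply: bc_trans (bc_cancel l).
apply: (@bc_cat [:: l] [:: l] _ [:: letter_inv l]); first exact: bc_refl.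
by apply: (@bc_cat _ [::]); [|exact: bc_refl].
Qed.

Lemma word_inv_cong u v :
  braid_cong u v -> braid_cong (word_inv u) (word_inv v).
Proof.
move=> uv; apply: (@bc_trans _ (word_inv u ++ (v ++ word_inv v))).
  rewrite -[X in braid_cong X _]cats0.
  by apply: bc_cat; [exact: bc_refl|apply/bc_sym/word_mulV].
rewrite catA -[X in braid_cong _ X]cat0s.
apply: bc_cat; last exact: bc_refl.
apply: (@bc_trans _ (word_inv u ++ u)).
  by apply: bc_cat; [exact: bc_refl|exact: bc_sym].
by rewrite -{2}[u]word_invK; apply: word_mulV.
Qed.

Definition B3_mul (a b : B3) : B3 := braid_of (repr a ++ repr b).
Definition B3_one : B3 := braid_of [::].
Definition B3_inv (a : B3) : B3 := braid_of (word_inv (repr a)).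

Lemma B3_mulE u v : B3_mul (braid_of u) (braid_of v) = braid_of (u ++ v).
Proof. by apply/braid_ofP; apply: bc_cat; apply: repr_braid_of. Qed.

Lemma B3_invE u : B3_inv (braid_of u) = braid_of (word_inv u).
Proof. by apply/braid_ofP/word_inv_cong/repr_braid_of. Qed.

Lemma B3_mulA : associative B3_mul.
Proof.
move=> a b c; rewrite -[a]braid_of_repr -[b]braid_of_repr -[c]braid_of_repr.
by rewrite !B3_mulE catA.
Qed.

Lemma B3_mul1 : left_id B3_one B3_mul.
Proof. by move=> a; rewrite -[a]braid_of_repr B3_mulE. Qed.

Lemma B3_mulr1 : right_id B3_one B3_mul.
Proof. by move=> a; rewrite -[a]braid_of_repr B3_mulE cats0. Qed.

Lemma B3_mulV : left_inverse B3_one B3_inv B3_mul.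
Proof.
move=> a; rewrite -[a]braid_of_repr B3_invE B3_mulE; apply/braid_ofP.
by rewrite -{2}[repr a]word_invK; apply: word_mulV.
Qed.

Lemma B3_mulrV : right_inverse B3_one B3_inv B3_mul.
Proof.
move=> a; rewrite -[a]braid_of_repr B3_invE B3_mulE; apply/braid_ofP.
exact: word_mulV.
Qed.

HB.instance Definition _ := isGroup.Build B3
  B3_mulA B3_mul1 B3_mulr1 B3_mulV B3_mulrV.

Lemma braid_ofM u v : braid_of (u ++ v) = braid_of u * braid_of v.
Proof. by rewrite -B3_mulE. Qed.

Lemma braid_of1 : braid_of [::] = 1.
Proof. by []. Qed.

Lemma braid_ofV u : braid_of (word_inv u) = (braid_of u)^-1.
Proof. by rewrite -B3_invE. Qed.

Definition sigma1 : B3 := braid_of [:: s1].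
Definition sigma2 : B3 := braid_of [:: s2].

Definition F2 : set B3 := @commutator_subgroup B3.
Definition gen_x : B3 := sigma1 * sigma2^-1.
Definition gen_y : B3 := sigma1 ^+ 2 * sigma2 ^- 2.

(* With the index shift above, this is (i+1)-positivity. *)
Definition positive_word (i : 'I_2) (w : word) : bool :=
  [&& all (fun l : letter => i <= l.1) w, (i, true) \in w
    & (i, false) \notin w].

Definition positive_braid (i : 'I_2) (b : B3) : Prop :=
  exists2 w, positive_word i w & b = braid_of w.

Definition P_D : set B3 := [set b | exists i, positive_braid i b].

(* Existence of the homomorphism F2 -> R with x |-> 1 and y |-> 0, read off
   from the affine action of B3 on R[t]/(t^2 - t + 1) where
   sigma_1 : z |-> t z + 1 and sigma_2 : z |-> t z. *)
Section F2Hom.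
Variable R : comNzRingType.
Local Open Scope ring_scope.

Let mt (z : R * R) : R * R := (- z.2, z.1 + z.2).
Let mtV (z : R * R) : R * R := (z.1 + z.2, - z.1).
Let act1 (l : letter) (z : R * R) : R * R :=
  if l.1 == ord0 then
    if l.2 then mt z + (1, 0) else mtV (z - (1, 0))
  else if l.2 then mt z else mtV z.
Let actw (w : word) (z : R * R) : R * R := foldr act1 z w.

Let mtVE z : mtV z = iter 5 mt z.
Proof. by case: z => u v; rewrite /mt /mtV /=; congr pair; ring. Qed.

Let iter_mtD k z z' : iter k mt (z + z') = iter k mt z + iter k mt z'.
Proof.
elim: k => //= k ->; case: (iter k mt z) (iter k mt z') => a b [c d].
by rewrite /mt /=; congr pair => /=; ring.
Qed.

Let iter_mt0 k : iter k mt 0 = 0.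
Proof. by elim: k => //= k ->; rewrite /mt /=; congr pair => /=; ring. Qed.

Let actw_cat u v z : actw (u ++ v) z = actw u (actw v z).
Proof. by rewrite /actw foldr_cat. Qed.

Let actw_cong u v : braid_cong u v -> actw u =1 actw v.
Proof.
elim=> {u v} [|u v _ IH|u v w _ IHu _ IHv|u u' v v' _ IHu _ IHv|[i b]|] z //.
- by rewrite IHu.
- by rewrite !actw_cat IHv IHu.
- case: z => u v; rewrite /actw /act1 /=.
  by case: (i == ord0); case: b => /=; rewrite /mt /mtV; congr pair => /=; ring.
- by case: z => u v; rewrite /actw /act1 /= /mt; congr pair => /=; ring.
Qed.

Let actw_affine w : exists k, forall z, actw w z = actw w 0 + iter k mt z.
Proof.
elim: w => [|l w [k IH]]; first by exists 0%N => z; rewrite add0r.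
suff [j Hj] : exists j, forall z, act1 l z = act1 l 0 + iter j mt z.
  exists (j + k)%N => z /=.
  by rewrite IH Hj iter_mtD addrA -Hj iterD.
case: l => i b; rewrite /act1 /=; case: (i == ord0); case: b.
- by exists 1%N => z; rewrite -[mt 0]/(iter 1 mt 0) iter_mt0 add0r addrC.
- by exists 5%N => z; rewrite !mtVE !iter_mtD iter_mt0 add0r addrC.
- by exists 1%N => z; rewrite -[mt 0]/(iter 1 mt 0) iter_mt0 add0r.
- by exists 5%N => z; rewrite !mtVE iter_mt0 add0r.
Qed.

Let actb (b : B3) := actw (repr b).

Let actb_of w z : actb (braid_of w) z = actw w z.
Proof. exact/actw_cong/repr_braid_of. Qed.

Let actbM a b z : actb (a * b)%g z = actb a (actb b z).
Proof.
by rewrite -[a]braid_of_repr -[b]braid_of_repr -braid_ofM !actb_of actw_cat.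
Qed.

Let actb1 z : actb 1%g z = z.
Proof. by rewrite -braid_of1 actb_of. Qed.

Let trans : set B3 := [set b | forall z, actb b z = actb b 0 + z].

Let trans_subgroup : is_subgroup trans.
Proof.
split; first by rewrite inE => z; rewrite !actb1 add0r.
move=> a b /[!inE] Ha Hb z; set c := (b^-1)%g.
have Hc w : actb c w = actb c 0 + w.
  have e t : actb b (actb c t) = t by rewrite -actbM mulgV actb1.
  apply: (addrI (actb b 0)); rewrite -Hb e addrA -Hb e.
  by rewrite add0r.
by rewrite !actbM Hc Ha addrA -Ha.
Qed.

Let F2_trans : F2 `<=` trans.
Proof.
move=> g; apply; first exact: trans_subgroup.
move=> _ [a [b ->]] z.
pose lin (c : B3) t := actb c t - actb c 0.
have actbE c t : actb c t = actb c 0 + lin c t by rewrite addrC subrK.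
have linE c : exists k, forall t, lin c t = iter k mt t.
  have [k Hk] := actw_affine (repr c).
  by exists k => t; rewrite /lin /actb Hk addrC addKr.
have linC c d t : lin c (lin d t) = lin d (lin c t).
  have [k Hk] := linE c; have [j Hj] := linE d.
  by rewrite !Hk !Hj -!iterD addnC.
have linM c d t : lin (c * d)%g t = lin c (lin d t).
  have [k Hk] := linE c.
  have -> : lin (c * d)%g t = lin c (actb d t) - lin c (actb d 0).
    by rewrite /lin !actbM opprB addrA subrK.
  by rewrite (actbE d t) !Hk iter_mtD addrC addKr.
have lin1 t : lin 1%g t = t by rewrite /lin !actb1 subr0.
rewrite actbE; congr (_ + _).
rewrite /commg /conjg !linM (linC b^-1%g) -!linM.
by rewrite -[X in lin X]mulgA mulgA mulVg mul1g mulVg lin1.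
Qed.

Lemma F2_hom_exists :
  exists phi : B3 -> R, [/\ additive_on F2 phi, phi gen_x = 1 & phi gen_y = 0].
Proof.
exists (fun b => (actb b 0).1 - (actb b 0).2); split.
- move=> g h /F2_trans Hg _; rewrite actbM Hg.
  by case: (actb g 0) (actb h 0) => a b [c d] /=; ring.
- rewrite /gen_x /sigma1 /sigma2 -braid_ofV -braid_ofM actb_of.
  by rewrite /actw /act1 /= /mt /mtV /=; ring.
- have -> : gen_y = braid_of ([:: s1; s1] ++ word_inv [:: s2; s2]).
    rewrite (braid_ofM [:: s1; s1]) braid_ofV.
    by rewrite (braid_ofM [:: s1] [:: s1]) (braid_ofM [:: s2] [:: s2]).
  by rewrite actb_of /actw /act1 /= /mt /mtV /=; ring.
Qed.

End F2Hom.

(* Main.v *)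
Require Import Defs.
From mathcomp Require Import all_boot all_order all_algebra zify.
From mathcomp Require Import boolp classical_sets.

(** Through the action of SL_2(Z) on the circle of lines of R^2, the group B_3
    acts on the universal cover of that circle, a real line.  Normalised, the
    centre, generated by Delta^2 = (sigma1 sigma2 sigma1)^2, acts as the
    translation by 1, and sigma2 fixes a point p, hence p + 1, and pushes every
    point of the interval between them to the right.  A 1-positive braid is one
    that moves p to the right, and the powers of sigma2 are the only braids
    that fix p.  Since F_2 contains no nontrivial power of sigma2, the
    Dehornoy ordering of F_2 is the ordering of the points g p.

    Let b be the commutator of x^-1 and y.  It equals Delta^2 sigma2^-6, so that
    g b p = g p + 1 for every g; it lies in the kernel K of phi because the
    target of phi is abelian; and its powers are cofinal (every braid becomes
    1-positive after multiplication by a power of Delta^2,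
    [positive_MDelta2X]).  So a convex subgroup C of K that contains b is K.

    Let C be convex and c in C with p < c p.  If c p >= p + 1, convexity gives
    b in C.  If c p < p + 1, conjugate c by powers of sigma2^6.  Up to a
    central factor sigma2^6 is b^-1, so these conjugates are in K.  For large m
    and k the element
      g = sigma2^(-6(m+k)) c sigma2^(6m) c^-1 sigma2^(6k)
    of K satisfies p < g p < c p, so g is in C, while g pushes c p beyond p + 1,
    so g c is in C and is at least b ([overshoot]).  Hence again b is in C.

    The points are only a guide: each inequality says that a certain braid is
    1-positive, and this follows from two facts about words.  The first is that
    every braid or its inverse has an expression without sigma1^-1
    ([nonneg_total]), which comes from a normal form of B_3 modulo its centre.  The second is that
    u sigma2^m v lies in Delta^2 times a 1-positive braid when u and v are
    1-positive and m is large ([positive_jump]); it says that sigma2^m moves the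
    point v p, which is to the right of p, as close to p + 1 as desired, or
    beyond it. *)

Set Implicit Arguments.
Unset Strict Implicit.
Unset Printing Implicit Defensive.

Import GRing.Theory.

Local Open Scope group_scope.
Local Open Scope classical_set_scope.

(** * The letters and the Garside element *)

Definition gen (l : letter) : B3 := braid_of [:: l].

Lemma letterP (P : letter -> Prop) :
  P s1 -> P (letter_inv s1) -> P s2 -> P (letter_inv s2) -> forall l, P l.
Proof.
move=> P1 P1' P2 P2' [i b].
have [->|->] : i = ord0 \/ i = ord_max.
- by case: i => [[|[|//]] lt_i]; [left|right]; apply: val_inj.
- by case: b.
- by case: b.
Qed.

Lemma gen_s1 : gen s1 = sigma1. Proof. by []. Qed.
Lemma gen_s2 : gen s2 = sigma2. Proof. by []. Qed.

Lemma gen_s1V : gen (letter_inv s1) = sigma1^-1.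
Proof. by rewrite /sigma1 -braid_ofV. Qed.

Lemma gen_s2V : gen (letter_inv s2) = sigma2^-1.
Proof. by rewrite /sigma2 -braid_ofV. Qed.

Lemma braid_of_cons l w : braid_of (l :: w) = gen l * braid_of w.
Proof. by rewrite -cat1s braid_ofM. Qed.

Lemma braid_rel : sigma1 * sigma2 * sigma1 = sigma2 * sigma1 * sigma2.
Proof.
by rewrite /sigma1 /sigma2 -!braid_ofM; apply/braid_ofP/bc_braid.
Qed.

Lemma braid_ind (P : B3 -> Prop) :
  P 1 -> (forall l g, P g -> P (gen l * g)) -> forall g, P g.
Proof.
move=> P1 Pgen g; rewrite -[g]braid_of_repr.
by elim: (repr g) => [|l w IHw]; rewrite ?braid_of1 // braid_of_cons; apply: Pgen.
Qed.

(** Locked: the product of B_3 unfolds, and rewriting with associativity would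
    otherwise look inside Delta. *)
Definition Delta : B3 := locked (sigma1 * sigma2 * sigma1).

Lemma DeltaE : Delta = sigma1 * sigma2 * sigma1.
Proof. by rewrite /Delta -lock. Qed.

(** Conjugation by Delta exchanges the two generators. *)
Definition flip (l : letter) : letter := (rev_ord l.1, l.2).

Lemma flip_s1 b : flip (ord0, b) = (ord_max, b).
Proof. by congr pair; apply: val_inj. Qed.

Lemma flip_s2 b : flip (ord_max, b) = (ord0, b).
Proof. by congr pair; apply: val_inj. Qed.

Lemma Delta_sigma1 : Delta * sigma1 = sigma2 * Delta.
Proof. by rewrite {1}DeltaE braid_rel DeltaE -!mulgA. Qed.

Lemma Delta_sigma2 : Delta * sigma2 = sigma1 * Delta.
Proof. by rewrite {2}DeltaE braid_rel DeltaE -!mulgA. Qed.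

Lemma Delta_sigma1V : Delta * sigma1^-1 = sigma2^-1 * Delta.
Proof. by apply: (mulIg sigma1); rewrite mulgVK -mulgA Delta_sigma1 mulKg. Qed.

Lemma Delta_sigma2V : Delta * sigma2^-1 = sigma1^-1 * Delta.
Proof. by apply: (mulIg sigma2); rewrite mulgVK -mulgA Delta_sigma2 mulKg. Qed.

Lemma Delta_gen l : Delta * gen l = gen (flip l) * Delta.
Proof.
move: l; apply: letterP.
- by rewrite flip_s1 Delta_sigma1.
- by rewrite flip_s1 gen_s1V Delta_sigma1V -gen_s2V.
- by rewrite flip_s2 Delta_sigma2.
- by rewrite flip_s2 gen_s2V Delta_sigma2V -gen_s1V.
Qed.

Lemma flipK : cancel flip flip.
Proof. by case=> i b; rewrite /flip /= rev_ordK. Qed.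

Lemma Delta_word w : Delta * braid_of w = braid_of (map flip w) * Delta.
Proof.
elim: w => [|l w IHw]; first by rewrite braid_of1 mul1g mulg1.
by rewrite map_cons !braid_of_cons mulgA Delta_gen -!mulgA IHw.
Qed.

Definition Delta2 : B3 := locked (Delta * Delta).

Lemma Delta2E : Delta2 = Delta * Delta.
Proof. by rewrite /Delta2 -lock. Qed.

Lemma Delta2C g : commute Delta2 g.
Proof.
rewrite -[g]braid_of_repr; move: (repr g) => w.
rewrite /commute Delta2E -mulgA (Delta_word w) mulgA (Delta_word (map flip w)).
by rewrite (mapK flipK) mulgA.
Qed.

Lemma Delta2XC n g : commute (Delta2 ^+ n) g.
Proof. by apply/commute_sym/commuteX/commute_sym/Delta2C. Qed.

Lemma Delta_exp_gen n l : exists l', gen l * Delta ^+ n = Delta ^+ n * gen l'.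
Proof.
elim: n => [|n [l' IHn]]; first by exists l; rewrite mulg1 mul1g.
exists (flip l'); rewrite expgSr mulgA IHn -!mulgA Delta_gen.
by rewrite flipK.
Qed.

(** * Braids spelled with given letters *)

Definition spelled (A : pred letter) (g : B3) : Prop :=
  exists2 w, all A w & g = braid_of w.

Lemma spelled1 A : spelled A 1.
Proof. by exists [::]. Qed.

Lemma spelled_gen (A : pred letter) l : A l -> spelled A (gen l).
Proof. by move=> Al; exists [:: l]; rewrite //= Al. Qed.

Lemma spelledM A g h : spelled A g -> spelled A h -> spelled A (g * h).
Proof.
move=> [u Au ->] [v Av ->]; exists (u ++ v); last by rewrite braid_ofM.
by rewrite all_cat Au.
Qed.

Lemma spelledX A g n : spelled A g -> spelled A (g ^+ n).
Proof.
move=> Ag; elim: n => [|n IHn]; first exact: spelled1.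
by rewrite expgS; apply: spelledM.
Qed.

Lemma spelledV A g : spelled A g -> spelled (A \o letter_inv) g^-1.
Proof.
move=> [w Aw ->]; exists (word_inv w); last by rewrite braid_ofV.
rewrite all_rev all_map; apply: sub_all Aw => l /=.
by rewrite letter_invK.
Qed.

Lemma spelledJ A g : spelled A g -> spelled (A \o flip) (Delta * g * Delta^-1).
Proof.
move=> [w Aw ->]; exists (map flip w); last by rewrite Delta_word mulgK.
by rewrite all_map; apply: sub_all Aw => l /=; rewrite flipK.
Qed.

Lemma spelled_sub (A B : pred letter) g : {subset A <= B} -> spelled A g -> spelled B g.
Proof. by move=> AB [w Aw ->]; exists w => //; apply: sub_all Aw => l; apply: AB. Qed.

Definition nonneg : B3 -> Prop := spelled (predC1 (letter_inv s1)).

(** The letters are sigma1 and sigma2^-1 for [e = true], and their inverses for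
    [e = false].  Both inversion and conjugation by Delta exchange the two
    monoids.  Under sigma1 -> (1 1; 0 1) and sigma2 -> (1 0; -1 1) the letters
    for [e = true] become the two elementary matrices that generate the monoid
    of nonnegative matrices of SL_2(Z). *)
Definition alternating_letter (e : bool) : pred letter :=
  fun l => l.2 == ((l.1 == ord0) == e).

Definition alternating (e : bool) : B3 -> Prop :=
  spelled (alternating_letter e).

Lemma alternatingV e g : alternating e g -> alternating (~~ e) g^-1.
Proof.
move/spelledV; apply: spelled_sub; apply: letterP; by case: e.
Qed.

Lemma alternatingJ e g :
  alternating e g -> alternating (~~ e) (Delta * g * Delta^-1).
Proof.
move/spelledJ; apply: spelled_sub; apply: letterP; by case: e.
Qed.

Lemma alternating_nonneg g : alternating true g -> nonneg g.
Proof. by apply: spelled_sub; apply: letterP. Qed.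

Lemma nonneg_sigma1 : nonneg sigma1. Proof. exact: spelled_gen. Qed.
Lemma nonneg_sigma2 : nonneg sigma2. Proof. exact: spelled_gen. Qed.
Lemma nonneg_sigma2V : nonneg sigma2^-1.
Proof. by rewrite -gen_s2V; apply: spelled_gen. Qed.
Lemma nonnegM g h : nonneg g -> nonneg h -> nonneg (g * h).
Proof. exact: spelledM. Qed.
Lemma nonneg_Delta : nonneg Delta.
Proof.
rewrite DeltaE; do !apply: nonnegM => //; try exact: nonneg_sigma1.
exact: nonneg_sigma2.
Qed.

(** * Every braid or its inverse avoids sigma1^-1 *)

(** A letter in front of a word of the opposite kind either cancels the first
    letter or merges with it into one letter, at the cost of one factor Delta
    or Delta^-1: for instance sigma2 sigma1 = Delta sigma2^-1.  The power of
    Delta^2 on the left stands for a negative power of Delta on the right. *)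
Lemma mismatched_letters e l l0 : ~~ alternating_letter e l -> alternating_letter e l0 ->
  exists n i h, Delta2 ^+ n * (gen l * gen l0) = Delta ^+ i * h /\ alternating e h.
Proof.
have E1 : sigma1 * sigma2 = Delta * sigma1^-1 by rewrite DeltaE mulgK.
have E2 : sigma2 * sigma1 = Delta * sigma2^-1.
  by rewrite DeltaE braid_rel mulgK.
have E3 : Delta2 * (sigma1^-1 * sigma2^-1) = Delta * sigma1.
  by rewrite -invgM E2 invgM invgK Delta2E -mulgA (mulgA _ sigma2) Delta_sigma2 mulgK.
have E4 : Delta2 * (sigma2^-1 * sigma1^-1) = Delta * sigma2.
  by rewrite -invgM E1 invgM invgK Delta2E -mulgA (mulgA _ sigma1) Delta_sigma1 mulgK.
have inverse : gen l * gen l0 = 1 -> exists n i h,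
    Delta2 ^+ n * (gen l * gen l0) = Delta ^+ i * h /\ alternating e h.
  move=> ->; exists 0%N, 0%N, 1; split=> //.
  exact: spelled1.
move: l l0 inverse; apply: letterP => l0; move: l0; apply: letterP => inverse;
  case: e inverse => // inverse _ _;
  rewrite ?gen_s1V ?gen_s2V ?gen_s1 ?gen_s2 in inverse *.
- by apply: inverse; rewrite mulgV.
- exists 0%N, 1%N, (gen (letter_inv s1)); split; last exact: spelled_gen.
  by rewrite gen_s1V mul1g.
- by apply: inverse; rewrite mulVg.
- exists 1%N, 1%N, (gen s1); split; last exact: spelled_gen.
  by rewrite gen_s1.
- exists 0%N, 1%N, (gen (letter_inv s2)); split; last exact: spelled_gen.
  by rewrite gen_s2V mul1g.
- by apply: inverse; rewrite mulgV.
- exists 1%N, 1%N, (gen s2); split; last exact: spelled_gen.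
  by rewrite gen_s2.
- by apply: inverse; rewrite mulVg.
Qed.

Lemma gen_alternating e l v : alternating e v ->
  exists n i v' e', Delta2 ^+ n * (gen l * v) = Delta ^+ i * v' /\ alternating e' v'.
Proof.
move=> [w Aw ->].
have [Al|nAl] := boolP (alternating_letter e l).
  exists 0%N, 0%N, (gen l * braid_of w), e; split; first by rewrite !mul1g.
  by apply: spelledM; [exact: spelled_gen|exists w].
case: w Aw => [_|l0 w /= /andP[Al0 Aw]].
  exists 0%N, 0%N, (gen l), (~~ e); split; first by rewrite !mul1g braid_of1 mulg1.
  apply: spelled_gen; move: l nAl; apply: letterP; by case: e.
have [n [i [h [Eh Ah]]]] := mismatched_letters nAl Al0.
exists n, i, (h * braid_of w), e; split.
  by rewrite braid_of_cons !mulgA -Eh !mulgA.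
by apply: spelledM => //; exists w.
Qed.

Lemma normal_form g :
  exists n i v e, Delta2 ^+ n * g = Delta ^+ i * v /\ alternating e v.
Proof.
elim/braid_ind: g => [|l g [n [i [v [e [Eg Av]]]]]].
  by exists 0%N, 0%N, 1, true; split; [rewrite !mul1g|exact: spelled1].
have [l' El] := Delta_exp_gen i l.
have [n' [i' [v' [e' [Ev Av']]]]] := gen_alternating l' Av.
exists (n' + n)%N, (i + i')%N, v', e'; split=> //.
rewrite !expgnDr -[LHS]mulgA (mulgA (Delta2 ^+ n)) (Delta2XC n (gen l)).
rewrite -(mulgA (gen l)) Eg (mulgA (gen l)) El -(mulgA (Delta ^+ i)) mulgA.
by rewrite Delta2XC -mulgA Ev mulgA.
Qed.

Lemma Delta_conjV g : Delta * g * Delta^-1 = Delta^-1 * g * Delta.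
Proof.
apply: (mulgI Delta); apply: (mulIg Delta); rewrite !mulgA mulgVK mulgV mul1g.
by rewrite -Delta2E Delta2C Delta2E mulgA.
Qed.

(** A word in sigma1^-1 and sigma2 becomes a word in sigma2^-1 and sigma1 when
    a factor Delta moves from one side of it to the other. *)
Lemma nonneg_DeltaM n v e : alternating e v -> nonneg (Delta ^+ n.+1 * v).
Proof.
move=> Av; have Nn := spelledX n nonneg_Delta.
case: e Av => Av.
  apply: nonnegM; last exact: alternating_nonneg.
  exact: (spelledX n.+1 nonneg_Delta).
rewrite expgSr -mulgA -[Delta * v](mulgVK Delta).
apply: nonnegM => //; apply: nonnegM; last exact: nonneg_Delta.
exact: alternating_nonneg (alternatingJ Av).
Qed.

Lemma nonneg_MDelta n v e : alternating e v -> nonneg (v * Delta ^+ n.+1).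
Proof.
move=> Av; have Nn := spelledX n nonneg_Delta.
case: e Av => Av.
  apply: nonnegM; first exact: alternating_nonneg.
  exact: (spelledX n.+1 nonneg_Delta).
rewrite expgS mulgA -[v * Delta](mulVKg Delta) (mulgA _ v) -Delta_conjV.
apply: nonnegM => //; apply: nonnegM; first exact: nonneg_Delta.
exact: alternating_nonneg (alternatingJ Av).
Qed.

(** In the normal form the exponent of Delta decides which of the two holds. *)
Lemma nonneg_total g : nonneg g \/ nonneg g^-1.
Proof.
have [n [i [v [e [Eg Av]]]]] := normal_form g.
have Dn : Delta2 ^+ n = Delta ^+ (2 * n) by rewrite expgnA Delta2E.
have [lt_ni|lt_in|eq_in] := ltngtP (2 * n) i.
- left; suff -> : g = Delta ^+ (i - 2 * n).-1.+1 * v by apply: nonneg_DeltaM Av.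
  apply: (mulgI (Delta2 ^+ n)); rewrite Eg mulgA Dn -expgnDr.
  by congr (Delta ^+ _ * v); lia.
- right; suff -> : g^-1 = v^-1 * Delta ^+ (2 * n - i).-1.+1.
    exact: nonneg_MDelta (alternatingV Av).
  apply: (mulgI v); apply: (mulgI (Delta ^+ i)); rewrite mulVKg mulgA -Eg mulgK.
  by rewrite Dn -expgnDr; congr (Delta ^+ _); lia.
- have -> : g = v by apply: (mulgI (Delta2 ^+ n)); rewrite Eg Dn eq_in.
  case: e Av => Av; [left|right]; apply: alternating_nonneg => //.
  exact: alternatingV Av.
Qed.

(** * The 1-positive braids *)

Notation positive := (positive_braid ord0).

Lemma notin_all (x : letter) w : (x \notin w) = all (predC1 x) w.
Proof. by rewrite -has_pred1 -all_predC. Qed.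

Lemma positive_sigma1_between u v : nonneg u -> nonneg v -> positive (u * sigma1 * v).
Proof.
move=> [u' Nu ->] [v' Nv ->]; exists (u' ++ s1 :: v').
  apply/and3P; split; first exact/allP.
    by rewrite mem_cat mem_head orbT.
  by rewrite notin_all all_cat; apply/andP.
by rewrite braid_ofM braid_of_cons mulgA.
Qed.

Lemma positive_split g : positive g ->
  exists u v, [/\ nonneg u, nonneg v & g = u * sigma1 * v].
Proof.
move=> [w /and3P[_ /splitPr[u v] Nw] ->].
move: Nw; rewrite notin_all all_cat => /andP[Nu /= Nv].
exists (braid_of u), (braid_of v); split; [by exists u|by exists v|].
by rewrite braid_ofM braid_of_cons mulgA.
Qed.

Lemma positive_sigma1 : positive sigma1.
Proof.
by rewrite -[sigma1]mulg1 -[sigma1]mul1g; apply: positive_sigma1_between; apply: spelled1.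
Qed.

Lemma positive_nonnegM g u : positive g -> nonneg u -> positive (g * u).
Proof.
move=> /positive_split[v [w [Nv Nw ->]]] Nu.
by rewrite -mulgA; apply: positive_sigma1_between => //; apply: nonnegM.
Qed.

Lemma nonneg_positiveM g u : positive g -> nonneg u -> positive (u * g).
Proof.
move=> /positive_split[v [w [Nv Nw ->]]] Nu.
by rewrite !mulgA; apply: positive_sigma1_between => //; apply: nonnegM.
Qed.

Lemma positive_nonneg g : positive g -> nonneg g.
Proof.
move=> /positive_split[u [v [Nu Nv ->]]].
by do !apply: nonnegM => //; apply: nonneg_sigma1.
Qed.

(** The powers of sigma2 with an integer exponent, the difference of the two
    natural numbers. *)
Definition sigma2_power (g : B3) : Prop :=
  exists i j, g * sigma2 ^+ i = sigma2 ^+ j.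

Lemma sigma2_power1 : sigma2_power 1.
Proof. by exists 0%N, 0%N; rewrite mulg1. Qed.

Lemma sigma2_powerC p n : sigma2_power p -> commute p (sigma2 ^+ n).
Proof.
move=> [i [j Ep]]; have -> : p = sigma2 ^+ j * sigma2 ^- i by rewrite -Ep mulgK.
apply/commute_sym/commuteM; last apply/commuteV; exact: commuteX2.
Qed.

Lemma sigma2_powerM p q : sigma2_power p -> sigma2_power q -> sigma2_power (p * q).
Proof.
move=> [i [j Ep]] Sq; have Cq := sigma2_powerC i Sq; have [k [l Eq]] := Sq.
exists (i + k)%N, (j + l)%N.
by rewrite !expgnDr mulgA -(mulgA p) Cq mulgA Ep -mulgA Eq.
Qed.

Lemma sigma2_power_gen l : l.1 = ord_max -> sigma2_power (gen l).
Proof.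
case: l => i [] /= ->; first by exists 0%N, 1%N; rewrite mulg1.
by exists 1%N, 0%N; rewrite gen_s2V mulVg.
Qed.

Lemma nonneg_first g : nonneg g -> sigma2_power g \/
  exists p v, [/\ sigma2_power p, nonneg v & g = p * sigma1 * v].
Proof.
move=> [w Nw ->]; elim: w Nw => [_|l w IHw /= /andP[Nl Nw]].
  by left; apply: sigma2_power1.
have [El|El] : l = s1 \/ l.1 = ord_max.
- move: l Nl; apply: letterP; by [left|right].
- right; exists 1, (braid_of w); split; [exact: sigma2_power1|by exists w|].
  by rewrite braid_of_cons El mul1g.
- rewrite braid_of_cons; have [Sw|[p [v [Sp Nv ->]]]] := IHw Nw.
    by left; apply: sigma2_powerM => //; apply: sigma2_power_gen.
  right; exists (gen l * p), v; split; rewrite ?mulgA //.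
  by apply: sigma2_powerM => //; apply: sigma2_power_gen.
Qed.

Lemma nonneg_last g : nonneg g -> sigma2_power g \/
  exists u p, [/\ nonneg u, sigma2_power p & g = u * sigma1 * p].
Proof.
move=> [w Nw ->]; elim/last_ind: w Nw => [_|w l IHw].
  by left; apply: sigma2_power1.
rewrite all_rcons => /andP[Nl Nw]; rewrite -cats1 braid_ofM.
have [El|El] : l = s1 \/ l.1 = ord_max.
- move: l Nl; apply: letterP; by [left|right].
- right; exists (braid_of w), 1; split; [by exists w|exact: sigma2_power1|].
  by rewrite El mulg1.
- have Sl := sigma2_power_gen El; have [Sw|[u [p [Nu Sp ->]]]] := IHw Nw.
    by left; apply: sigma2_powerM.
  right; exists u, (p * gen l); split; rewrite ?mulgA //.
  exact: sigma2_powerM.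
Qed.

Lemma positive_first g : positive g ->
  exists p v, [/\ sigma2_power p, nonneg v & g = p * sigma1 * v].
Proof.
move=> /positive_split[u [v [Nu Nv ->]]].
have [Su|[p [v' [Sp Nv' ->]]]] := nonneg_first Nu; first by exists u, v.
exists p, (v' * sigma1 * v); split; rewrite ?mulgA //.
by do !apply: nonnegM => //; apply: nonneg_sigma1.
Qed.

Lemma positive_last g : positive g ->
  exists u p, [/\ nonneg u, sigma2_power p & g = u * sigma1 * p].
Proof.
move=> /positive_split[u [v [Nu Nv ->]]].
have [Sv|[u' [p [Nu' Sp ->]]]] := nonneg_last Nv; first by exists u, v.
exists (u * sigma1 * u'), p; split; rewrite ?mulgA //.
by do !apply: nonnegM => //; apply: nonneg_sigma1.
Qed.

(** * Translation past Delta^2 *)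

(** This is the identity behind the exact amount by which sigma1 sigma2^m sigma1
    exceeds a full twist. *)
Lemma sigma1_sigma2X_sigma1 n :
  sigma1 * sigma2 ^+ n.+2 * sigma1 =
  Delta2 * (sigma2^-1 * sigma1 ^+ n * sigma2^-1).
Proof.
have E k : Delta * sigma1 ^+ k = sigma2 ^+ k * Delta.
  elim: k => [|k IHk]; first by rewrite mulg1 mul1g.
  by rewrite !expgS mulgA Delta_sigma1 -!mulgA IHk.
rewrite [sigma2 ^+ _]expgS expgSr.
rewrite Delta2E -!mulgA (mulgA Delta sigma2^-1) Delta_sigma2V.
rewrite -(mulgA sigma1^-1) (mulgA Delta (sigma1 ^+ n)) E.
rewrite !mulgA {1}DeltaE mulgK -!mulgA DeltaE braid_rel mulgK.
by [].
Qed.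

(** Only the last sigma1 of u and the first sigma1 of v matter: between them
    stands a power of sigma2 that grows with m. *)
Lemma positive_jump u v : positive u -> positive v ->
  exists m0, forall m, m0 <= m ->
    exists2 w, positive w & u * sigma2 ^+ m * v = Delta2 * w.
Proof.
move=> /positive_last[u' [p [Nu Sp ->]]] /positive_first[q [v' [Sq Nv ->]]].
have [i [j Ep]] := Sp; have [k [l Eq]] := Sq.
exists (i + 3 + k)%N => m le_m.
have [r [-> r3]] : exists r, m = (i + r + k)%N /\ 3 <= r.
  by exists (m - i - k)%N; lia.
set n := (j + r + l - 3)%N.
(* The exponent of sigma2 between the two letters sigma1 is at least 3: the
   identity uses up 2, and 1 more leaves a letter sigma1 in w. *)
have Epq : p * sigma2 ^+ (i + r + k) * q = sigma2 ^+ n.+3.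
  rewrite !expgnDr !mulgA Ep -[LHS]mulgA -(sigma2_powerC k Sq) Eq.
  by rewrite -!expgnDr; congr (_ ^+ _); lia.
exists (u' * sigma2^-1 * sigma1 ^+ n * sigma1 * (sigma2^-1 * v')).
  apply: positive_sigma1_between; last by apply: nonnegM => //; apply: nonneg_sigma2V.
  apply: nonnegM; last exact/spelledX/nonneg_sigma1.
  by apply: nonnegM => //; apply: nonneg_sigma2V.
have := sigma1_sigma2X_sigma1 n.+1; rewrite [sigma1 ^+ n.+1]expgSr.
move: (sigma2 ^+ n.+3) (sigma1 ^+ n) Epq => X Y Epq EX.
rewrite !mulgA (Delta2C u') -!mulgA; congr (u' * _).
rewrite (mulgA p) (mulgA (p * _)) Epq (mulgA X) (mulgA sigma1 (X * _)) (mulgA sigma1 X).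
by rewrite EX -!mulgA.
Qed.

Lemma nonneg_gen_Delta2 l : nonneg (gen l * Delta2).
Proof.
have N1 := nonneg_sigma1; have N2 := nonneg_sigma2; have ND := nonneg_Delta.
have ND2 : nonneg Delta2 by rewrite Delta2E; apply: nonnegM.
move: l; apply: letterP.
- exact: nonnegM.
- by rewrite gen_s1V Delta2E {1}DeltaE -!mulgA mulKg; do !apply: nonnegM.
- exact: nonnegM.
- by rewrite gen_s2V; apply: nonnegM => //; apply: nonneg_sigma2V.
Qed.

Lemma positive_Delta2 : positive Delta2.
Proof.
rewrite Delta2E; apply: nonneg_positiveM nonneg_Delta; rewrite DeltaE.
rewrite -mulgA; apply: (positive_nonnegM positive_sigma1).
by apply: nonnegM; [apply: nonneg_sigma2|apply: nonneg_sigma1].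
Qed.

(** Each letter is made nonnegative by a single Delta^2, which can be moved
    to it because it is central. *)
Lemma positive_MDelta2X g : exists m, positive (g * Delta2 ^+ m).
Proof.
elim/braid_ind: g => [|l g [m IHg]].
  by exists 1%N; rewrite mul1g; apply: positive_Delta2.
exists m.+1.
have -> : gen l * g * Delta2 ^+ m.+1 = gen l * Delta2 * (g * Delta2 ^+ m).
  by rewrite expgS; move: (Delta2 ^+ m) => X; rewrite -!mulgA (mulgA Delta2) (Delta2C g) -mulgA.
by apply: nonneg_positiveM => //; apply: nonneg_gen_Delta2.
Qed.

(** * The commutator subgroup *)

Lemma subgroupM (G : groupType) (C : set G) :
  is_subgroup C -> forall g h, C g -> C h -> C (g * h).
Proof.
by move=> /group_closedM CM g h; have := CM g h; rewrite !inE.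
Qed.

Lemma subgroupV (G : groupType) (C : set G) :
  is_subgroup C -> forall g, C g -> C g^-1.
Proof. by move=> /group_closedV CV g; have := CV g; rewrite !inE. Qed.

Lemma subgroup1 (G : groupType) (C : set G) : is_subgroup C -> C 1.
Proof. by case; rewrite inE. Qed.

Lemma is_subgroupP (G : groupType) (C : set G) :
  C 1 -> (forall g h, C g -> C h -> C (g * h)) -> (forall g, C g -> C g^-1) ->
  is_subgroup C.
Proof.
move=> C1 CM CV; split; first by rewrite inE.
by move=> g h; rewrite !inE => Cg Ch; apply/CM/CV.
Qed.

Lemma subgroupX (G : groupType) (C : set G) :
  is_subgroup C -> forall g n, C g -> C (g ^+ n).
Proof.
move=> subC g n Cg; elim: n => [|n IHn]; first exact: subgroup1.
by rewrite expgS; apply: subgroupM.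
Qed.

Definition word_exponent (w : word) : int :=
  (\sum_(l <- w) (if l.2 then 1 else -1))%R.

Lemma word_exponent_cong u v :
  braid_cong u v -> word_exponent u = word_exponent v.
Proof.
elim=> {u v} [|u v _ IH|u v w _ IHu _ IHv|u u' v v' _ IHu _ IHv|[i b]|] //.
- by rewrite IHu.
- by move: IHu IHv; rewrite /word_exponent !big_cat /= => -> ->.
- by rewrite /word_exponent !big_cons big_nil; case: b.
- by rewrite /word_exponent !big_cons.
Qed.

Definition exponent (g : B3) : int := word_exponent (repr g).

Lemma exponent_word w : exponent (braid_of w) = word_exponent w.
Proof. exact/word_exponent_cong/repr_braid_of. Qed.

Lemma exponentM g h : exponent (g * h) = (exponent g + exponent h)%R.
Proof.
by rewrite exponent_word /word_exponent big_cat.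
Qed.

Lemma exponent1 : exponent 1 = 0%R.
Proof. by rewrite exponent_word /word_exponent big_nil. Qed.

Lemma exponentV g : exponent g^-1 = (- exponent g)%R.
Proof.
by apply: (addrI (exponent g)); rewrite subrr -exponentM mulgV exponent1.
Qed.

Lemma exponent_sigma2X n : exponent (sigma2 ^+ n) = Posz n.
Proof.
elim: n => [|n IHn]; first exact: exponent1.
rewrite expgS exponentM IHn exponent_word /word_exponent big_cons big_nil /=.
by rewrite addr0.
Qed.

Lemma F2_exponent g : F2 g -> exponent g = 0%R.
Proof.
move=> Fg; apply: (Fg [set h | exponent h = 0%R]); last first.
  move=> _ [a [b ->]] /=.
  by rewrite /commg /conjg !exponentM !exponentV; lia.
apply: is_subgroupP => /= [|u v Eu Ev|u Eu]; first exact: exponent1.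
  by rewrite exponentM Eu Ev.
by rewrite exponentV Eu.
Qed.

Lemma F2_sigma2_power g : F2 g -> sigma2_power g -> g = 1.
Proof.
move=> /F2_exponent Eg [i [j Ep]].
have Eij : i = j.
  have := congr1 exponent Ep.
  by rewrite exponentM Eg !exponent_sigma2X add0r => -[].
by apply: (mulIg (sigma2 ^+ i)); rewrite mul1g {2}Eij.
Qed.

Lemma F2_subgroup : is_subgroup F2.
Proof.
apply: is_subgroupP => [C subC _|g h Fg Fh C subC sC|g Fg C subC sC].
- exact: subgroup1.
- by apply: subgroupM => //; [apply: Fg|apply: Fh].
- by apply: subgroupV => //; apply: Fg.
Qed.

(** A braid without sigma1^-1 whose exponent sum vanishes cannot be a power of
    sigma2 other than 1, so it contains sigma1. *)
Lemma F2_total g : F2 g -> [\/ g = 1, positive g | positive g^-1].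
Proof.
have npos h : F2 h -> nonneg h -> h = 1 \/ positive h.
  move=> Fh /nonneg_first[/F2_sigma2_power Sh|[p [v [Sp Nv ->]]]].
    by left; apply: Sh.
  right; have [i [j Ep]] := Sp; apply: positive_sigma1_between => //.
  have -> : p = sigma2 ^+ j * sigma2^-1 ^+ i by rewrite expVgn -Ep mulgK.
  by apply: nonnegM; apply: spelledX; [apply: nonneg_sigma2|apply: nonneg_sigma2V].
move=> Fg; have [Ng|Ng] := nonneg_total g.
  by have [->|Pg] := npos g Fg Ng; [apply: Or31|apply: Or32].
have [Eg|Pg] := npos g^-1 (subgroupV F2_subgroup Fg) Ng; last exact: Or33.
by apply: Or31; rewrite -[g]invgK Eg invg1.
Qed.

Lemma F2_comm g h : F2 [~ g, h].
Proof. by move=> C _; apply; exists g, h. Qed.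

(** Because sigma1 and sigma2 are conjugate. *)
Lemma F2_sigma1_sigma2 n : F2 (sigma1 ^+ n * sigma2 ^- n).
Proof.
have -> : sigma1 = sigma2 ^ (sigma1 * sigma2).
  by rewrite conjgE (mulgA sigma2) -braid_rel mulKg.
rewrite -conjXg -[sigma2 ^+ n]invgK; move: (sigma2 ^- n) (sigma1 * sigma2) => u w.
rewrite invgK conjgE -mulgA -mulgA -[u^-1 * (w * u)]conjgE; exact: F2_comm.
Qed.

Lemma F2_gen_x : F2 gen_x.
Proof. exact: (F2_sigma1_sigma2 1). Qed.

Lemma F2_gen_y : F2 gen_y.
Proof. exact: F2_sigma1_sigma2. Qed.

(** F_2 is the fundamental group of a once-punctured torus, on which x and y
    are a basis of curves; this element is the loop around the puncture. *)
Definition boundary : B3 := locked [~ gen_x^-1, gen_y].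

Lemma boundaryE : boundary = Delta2 * sigma2 ^- 6.
Proof.
apply: (mulIg (sigma2 ^+ 6)); rewrite mulgVK Delta2E {1}DeltaE braid_rel DeltaE.
rewrite /boundary -lock /commg /conjg /gen_x /gen_y.
move: sigma1 sigma2 braid_rel => a b E.
rewrite !expgS !expg0 !mulg1; rewrite !gnorm.
transitivity (a * b * a^-1 * a^-1 * (a * b * a) * b * b * b).
  by rewrite E !mulgA.
transitivity (a * b * a^-1 * (a * b * a) * b * b).
  by rewrite {2}E !gnorm.
transitivity (a * b * (b * a * b) * b); first by rewrite !gnorm.
transitivity (a * b * (a * b * a) * b); first by rewrite E.
transitivity (a * b * a * (b * a * b)); first by rewrite !mulgA.
by rewrite -E !mulgA.
Qed.

Lemma boundary_exp n : boundary ^+ n = Delta2 ^+ n * sigma2 ^- (6 * n).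
Proof.
rewrite boundaryE expgMn; last exact: Delta2C.
by rewrite -[in LHS]expVgn -expgnA expVgn.
Qed.

Lemma boundary_expV n : boundary ^- n = sigma2 ^+ (6 * n) * Delta2 ^- n.
Proof. by rewrite boundary_exp invgM invgK. Qed.

Lemma additive_on1 (V : zmodType) (phi : B3 -> V)
    (phi_hom : additive_on F2 phi) :
  phi 1 = 0%R.
Proof.
have F1 := subgroup1 F2_subgroup.
by apply: (addrI (phi 1)); rewrite -phi_hom // mulg1 addr0.
Qed.

Lemma additive_onV (V : zmodType) (phi : B3 -> V)
    (phi_hom : additive_on F2 phi) g :
  F2 g -> phi g^-1 = (- phi g)%R.
Proof.
move=> Fg; apply: (addrI (phi g)); rewrite -phi_hom //; last exact: (subgroupV F2_subgroup).
by rewrite mulgV additive_on1 // subrr.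
Qed.

Lemma kernel_subgroup (V : zmodType) (phi : B3 -> V)
    (phi_hom : additive_on F2 phi) :
  is_subgroup (kernel_on F2 phi).
Proof.
apply: is_subgroupP => [|g h [Fg Eg] [Fh Eh]|g [Fg Eg]]; split.
- exact: subgroup1 F2_subgroup.
- exact: additive_on1 phi_hom.
- exact: (subgroupM F2_subgroup).
- by rewrite phi_hom // Eg Eh addr0.
- exact: (subgroupV F2_subgroup).
- by rewrite (additive_onV phi_hom) // Eg oppr0.
Qed.

Lemma kernel_comm (V : zmodType) (phi : B3 -> V)
    (phi_hom : additive_on F2 phi) g h :
  F2 g -> F2 h -> kernel_on F2 phi [~ g, h].
Proof.
move=> Fg Fh; split; first exact: F2_comm.
have FgV := subgroupV F2_subgroup Fg; have FhV := subgroupV F2_subgroup Fh.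
have FM := subgroupM F2_subgroup; have Fgh := FM _ _ Fg Fh.
rewrite /commg /conjg !phi_hom ?(additive_onV phi_hom) //; last exact: FM.
by rewrite addrA -opprD addNr.
Qed.

Lemma kernel_boundary (V : zmodType) (phi : B3 -> V)
    (phi_hom : additive_on F2 phi) :
  kernel_on F2 phi boundary.
Proof.
rewrite /boundary -lock; apply: (kernel_comm phi_hom) F2_gen_y.
exact: (subgroupV F2_subgroup F2_gen_x).
Qed.

Lemma positive_boundary : positive boundary.
Proof.
rewrite boundaryE -expVgn; apply: (positive_nonnegM positive_Delta2).
exact/spelledX/nonneg_sigma2V.
Qed.

(** * Overshooting the translation *)

(** The hypotheses say p < c p < p + 1.  Write h = sigma2^(-6k) c and t = sigma2^6.
    Then g = t^-(m+k) c t^m c^-1 t^k is t^-m (h t^m h^-1), and it lies in every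
    subgroup that contains c and the boundary, because the boundary is t^-1
    times a central element.  The map h t^m h^-1 pushes points to the right but
    stops at its fixed points h p and h p + 1, where p < h p < c p for k > 0.
    So it moves p to a point between p and h p, and for large m it moves c p beyond
    p + 1.  The final factor t^-m pushes to the left but fixes p and p + 1, so
    g p is still between p and c p, and g c p still beyond p + 1. *)
Lemma overshoot c : positive c -> positive (c^-1 * boundary) ->
  exists m k, let g := boundary ^+ (m + k) * c * boundary ^- m * c^-1 * boundary ^- k in
  [/\ positive g, positive (g^-1 * c) & positive (boundary^-1 * (g * c))].
Proof.
move=> Pc Pcz.
have NX k : nonneg (sigma2 ^+ k) by apply/spelledX/nonneg_sigma2.
have NV k : nonneg (sigma2 ^- k).
  by rewrite -expVgn; apply/spelledX/nonneg_sigma2V.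
have Pd : positive (c^-1 * Delta2).
  have -> : c^-1 * Delta2 = c^-1 * boundary * sigma2 ^+ 6.
    by rewrite boundaryE -[RHS]mulgA mulgVK.
  exact: positive_nonnegM.
have [m1 H1] := positive_jump Pc Pd.
have [k H2] := positive_jump Pd Pc.
(* Conjugates of large powers of sigma2 by c^-1 and by c move p to the right. *)
have conjV_pos l : k <= l -> positive (c^-1 * sigma2 ^+ l * c).
  move=> /H2[w Pw E]; suff -> : c^-1 * sigma2 ^+ l * c = w by [].
  apply: (mulgI Delta2); rewrite -E; move: (sigma2 ^+ l) => X.
  by rewrite !mulgA (Delta2C c^-1).
have conj_pos m : m1 <= m -> positive (c * sigma2 ^+ m * c^-1).
  move=> /H1[w Pw E]; suff -> : c * sigma2 ^+ m * c^-1 = w by [].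
  by apply: (mulgI Delta2); rewrite -E (Delta2C (c * _ * _)) mulgA.
have [m3 H3] := positive_jump Pc (conjV_pos (6 * k)%N ltac:(lia)).
exists (m1 + m3)%N, k; set m := (m1 + m3)%N => g.
have Eg : g = sigma2 ^- (6 * (m + k)) * (c * sigma2 ^+ (6 * m) * c^-1) * sigma2 ^+ (6 * k).
  have central_cancel (x y u v : B3) : commute x u -> commute y (u * v) ->
      y * x * u * x^-1 * v * y^-1 = u * v.
    by move=> Cx Cy; rewrite -(mulgA y) Cx mulgA mulgK -(mulgA y) Cy mulgK.
  transitivity (sigma2 ^- (6 * (m + k)) * c * sigma2 ^+ (6 * m) *
                (c^-1 * sigma2 ^+ (6 * k))); last by rewrite !mulgA.
  rewrite -(central_cancel (Delta2 ^+ m) (Delta2 ^+ k)); try exact: Delta2XC.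
  rewrite /g boundary_exp !boundary_expV -expgnDr (addnC k m).
  move: (Delta2 ^+ _) (Delta2 ^+ _) (Delta2 ^+ _) => X Y Z.
  by rewrite !mulgA.
split.
- rewrite Eg; apply: positive_nonnegM => //; apply: nonneg_positiveM => //.
  by apply: conj_pos; lia.
- have -> : g^-1 * c = sigma2 ^- (6 * k) * c * sigma2 ^- (6 * m) *
                       (c^-1 * sigma2 ^+ (6 * (m + k)) * c).
    rewrite Eg; move: (sigma2 ^+ _) (sigma2 ^+ _) (sigma2 ^+ _) => X Y Z.
    by rewrite !gnorm.
  apply: nonneg_positiveM; first by apply: conjV_pos; lia.
  by do !apply: nonnegM => //; apply: positive_nonneg.
- have [w Pw E] := H3 (6 * m)%N ltac:(lia).
  suff -> : boundary^-1 * (g * c) = sigma2 ^+ 6 * sigma2 ^- (6 * (m + k)) * w.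
    by apply: nonneg_positiveM => //; apply: nonnegM.
  have -> : g * c = sigma2 ^- (6 * (m + k)) * (Delta2 * w).
    by rewrite Eg -E; move: (sigma2 ^+ _) (sigma2 ^+ _) => X Y; rewrite !mulgA.
  rewrite boundaryE; move: (sigma2 ^+ _) (sigma2 ^+ _) => X Y.
  by rewrite (mulgA X^-1) -(Delta2C X^-1) invgM invgK -!mulgA mulKg.
Qed.

Theorem theorem2p5 (n : nat) (hn : 2 < n)
    (phi : B3 -> 'Z_(n.-1))
    (phi_hom : additive_on F2 phi)
    (phi_x : phi gen_x = 1%R) (phi_y : phi gen_y = 0%R)
    (C : set B3)
    (C_subgroup : is_subgroup C)
    (C_sub : C `<=` kernel_on F2 phi)
    (C_convex : convex_in (kernel_on F2 phi)
                  (cone_lt (kernel_on F2 phi `&` P_D)) C) :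
  C = [set 1%g] \/ C = kernel_on F2 phi.
Proof.
set K := kernel_on F2 phi in C_sub C_convex *.
have subK : is_subgroup K by exact: kernel_subgroup.
have KM := subgroupM subK; have KV := subgroupV subK; have KX := subgroupX subK.
have C1 := subgroup1 C_subgroup; have CM := subgroupM C_subgroup.
have CV := subgroupV C_subgroup.
have Kz : K boundary by exact: kernel_boundary.
have between g h : K g -> positive g -> C h -> positive (g^-1 * h) -> C g.
  move=> Kg Pg Ch Pgh; apply: (C_convex 1 g h) => //.
    by split; [rewrite invg1 mul1g|exists ord0; rewrite invg1 mul1g].
  split; last by exists ord0.
  by apply: KM; [apply: KV|apply: C_sub].
have [C_trivial|] := pselect (C `<=` [set 1]).
  left; apply/seteqP; split=> // _ ->; exact: C1.
move=> /existsNP[c0 /not_implyP[Cc0 /= nc0]].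
have [c Cc Pc] : exists2 c, C c & positive c.
  have [F2c0 _] := C_sub _ Cc0.
  have [|?|?] := F2_total F2c0; first by [].
    by exists c0.
  by exists c0^-1 => //; apply: CV.
have Cz : C boundary.
  have [F2zc _] : K (boundary^-1 * c).
    by apply: KM; [apply: KV|apply: C_sub].
  have [E|Pzc|Pcz] := F2_total F2zc.
  - suff <- : c = boundary by [].
    by apply: (mulgI boundary^-1); rewrite E mulVg.
  - exact: (between boundary c Kz positive_boundary Cc Pzc).
  - rewrite invgM invgK in Pcz.
    have [m [k [Pg Pgc Pzgc]]] := overshoot Pc Pcz.
    set g := _ * boundary ^- k in Pg Pgc Pzgc.
    have Kg : K g.
      have KzX i : K (boundary ^+ i) by apply: KX.
      have Kc : K c by apply: C_sub.
      have KcV := KV _ Kc; have KzV i := KV _ (KzX i).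
      exact: KM (KM _ _ (KM _ _ (KM _ _ (KzX _) Kc) (KzV m)) KcV) (KzV k).
    have Cg : C g by apply: (between g c).
    by apply: (between boundary (g * c)) => //;
      [exact: positive_boundary|exact: CM].
(* Powers of the boundary bound every element of K from above. *)
have Cpos g : K g -> positive g -> C g.
  move=> Kg Pg; have [m Pm] := positive_MDelta2X g^-1.
  apply: (between g (boundary ^+ m)) => //; first exact: subgroupX C_subgroup _ _ Cz.
  rewrite boundary_exp mulgA; apply: positive_nonnegM => //.
  by rewrite -expVgn; apply/spelledX/nonneg_sigma2V.
right; apply/seteqP; split=> // g Kg; have [F2g _] := Kg.
have [->|Pg|Pg] := F2_total F2g; [by []|exact: Cpos|].
rewrite -[g]invgK; apply: CV; apply: Cpos => //.
exact: KV.
Qed.
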